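(* Consider an instance of the energy-constrained scheduling problem with zero communication delays (defined in the context) with $m = 2$ processors. Let $(d_j)$ be the durations from a solution of program $P_3$, and let $\sigma$ be the schedule produced by the iterative procedure described in the context. Then $\sigma$ is a feasible schedule on the two processors (using at most $E$ energy, possibly with preemption and migration), and its makespan equals the optimal objective value of the linear program $\Pi(G, (d_j))$.
   Context: Problem (zero communication delays): we are given a finite set $J$ of $n$ tasks; $m$ identical processors; a directed acyclic graph $G$ on $J$ (edge $i \to j$: $i$ must finish before $j$ begins); for each task $j$ a convex, non-increasing energy function $e_j:[0,\infty)\to[0,\infty)$; and an energy bound $E \ge 0$. A schedule assigns each task a finite set of time intervals on processors (preemption and migration allowed, no recomputation); $d_j$ is the total length of $j$'s intervals. It is feasible if precedence holds (each $i$ with $i \to j$ has finished before $j$ begins), each processor runs at most one task at a time, and $\sum_j e_j(d_j) \le E$. The makespan is the latest completion time. $i <_G j$ means a directed path from $i$ to $j$ exists. Linear program $\Pi(H, (\hat d_j))$ for a DAG $H$ on task set $V$ and fixed durations $\hat d_j \ge 0$: variables $\ell_j \ge 0$ ($j \in V$) and $\ell_{ij} = \ell_{ji} \ge 0$ for unordered pairs of distinct tasks of $V$; constraints $\hat d_j = \ell_j + \sum_{i \ne j} \ell_{ij}$ for all $j$, and $\ell_{ij} = 0$ whenever $i <_H j$; minimize $\sum_j \ell_j + \sum_{\{i,j\}} \ell_{ij}$. Program $P_3$: the same as $\Pi(G,\cdot)$ but with the $d_j \ge 0$ also variables, plus the constraint $\sum_j e_j(d_j) \le E$. Procedure: set $G_0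 = G$, $\hat d^0_j = d_j$, and $\hat\sigma_0$ the empty schedule. For $l = 0, \dots, n-1$: let $S_l$ be the set of sources of $G_l$; take an optimal solution $(\ell^l)$ of $\Pi(G_l, (\hat d^l_j))$ together with a source $s_l \in S_l$ such that $\ell^l_{s_l j} = 0$ for all non-source tasks $j$ of $G_l$; obtain $\hat\sigma_{l+1}$ by appending to $\hat\sigma_l$ (after its end) a block in which $s_l$ runs alone for $\ell^l_{s_l}$ time, followed, for each other task $i$ of $G_l$, by a block of length $\ell^l_{s_l i}$ in which $s_l$ runs on one processor and $i$ on the other; set $G_{l+1} = G_l - \{s_l\}$ and $\hat d^{l+1}_i = \hat d^l_i - \ell^l_{s_l i}$. The output is $\sigma = \hat\sigma_n$. *)

(* Defs.v *)
From mathcomp Require Import all_boot all_order all_algebra.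
From mathcomp Require Import classical_sets set_interval reals convex.

Set Implicit Arguments.
Unset Strict Implicit.
Unset Printing Implicit Defensive.

Import Order.TTheory GRing.Theory Num.Theory.

Local Open Scope classical_set_scope.
Local Open Scope ring_scope.

Section Graph.
Variables (J : finType) (G : rel J).

(* [i <_G j]: a directed path with at least one edge leads from i to j. *)
Definition prec (i j : J) : bool := [exists k, G i k && connect G k j].

Definition acyclic : bool := [forall i, ~~ prec i i].

Definition induced (V : {set J}) : rel J :=
  fun i j => [&& i \in V, j \in V & G i j].

End Graph.

Definition sources (J : finType) (V : {set J}) (H : rel J) : {set J} :=
  [set j in V | [forall i in V, ~~ H i j]]%SET.

Definition energy_function (R : realType) (f : R -> R) : Prop :=
  [/\ forall x, 0 <= x -> 0 <= f x,
      forall x y, 0 <= x -> x <= y -> f y <= f x &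
      @convex_function R R^o `[0, +oo[%classic f].

Section Schedules.
Variables (R : realType) (J : finType) (m : nat).

(* Processor, start time and end time of one interval of execution. *)
Definition slot : Type := 'I_m * (R * R).
Definition proc (q : slot) : 'I_m := q.1.
Definition start (q : slot) : R := q.2.1.
Definition stop (q : slot) : R := q.2.2.

Definition schedule : Type := J -> seq slot.

Definition time_disjoint (p q : slot) : bool :=
  (stop p <= start q) || (stop q <= start p).

Definition duration (sigma : schedule) (j : J) : R :=
  \sum_(q <- sigma j) (stop q - start q).

(* All slots start at time 0 or later, so 0 is a neutral default; the empty
   schedule has makespan 0. *)
Definition makespan (sigma : schedule) : R :=
  \big[Num.max/0]_(j : J) \big[Num.max/0]_(q <- sigma j) stop q.

(* Precedence is required along paths and not only along edges: the two agree
   when every task has a slot, but a task of duration 0 has none, and the tasks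
   before and after it must still be ordered. *)
Record feasible (G : rel J) (e : J -> R -> R) (E : R) (sigma : schedule)
    : Prop := Feasible {
  feasible_slot : forall j q, q \in sigma j -> 0 <= start q < stop q;
  (* a task may be preempted and migrated, but never runs in parallel with
     itself *)
  feasible_task : forall j, pairwise time_disjoint (sigma j);
  feasible_prec : forall i j, prec G i j ->
    forall p q, p \in sigma i -> q \in sigma j -> stop p <= start q;
  feasible_proc : forall i j, i != j ->
    forall p q, p \in sigma i -> q \in sigma j -> proc p = proc q ->
    time_disjoint p q;
  feasible_energy : \sum_(j : J) e j (duration sigma j) <= E }.

Definition empty_schedule : schedule := fun _ => [::].

(* Appends a block of length [len] after the end of [sigma]; [b j] is the
   processor that runs [j] throughout the block, if any.  A block of length 0
   adds nothing. *)
Definition append_block (sigma : schedule) (b : J -> option 'I_m) (len : R)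
    : schedule :=
  fun j => if b j is Some p then
             if 0 < len
             then rcons (sigma j) (p, (makespan sigma, makespan sigma + len))
             else sigma j
           else sigma j.

End Schedules.

Section LinearProgram.
Variables (R : realType) (J : finType).

(* [alone l j] is l_j and [paired l i j] is l_ij; only the values at distinct
   tasks of the task set V are meaningful. *)
Record lpvar : Type := LPVar { alone : J -> R; paired : J -> J -> R }.

Variables (V : {set J}) (H : rel J).

Record Pi_feasible (d : J -> R) (l : lpvar) : Prop := PiFeasible {
  Pi_alone_ge0 : forall j, j \in V -> 0 <= alone l j;
  Pi_paired_ge0 : forall i j, i \in V -> j \in V -> i != j ->
    0 <= paired l i j;
  Pi_paired_sym : forall i j, i \in V -> j \in V -> i != j ->
    paired l i j = paired l j i;
  Pi_duration : forall j, j \in V ->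
    d j = alone l j + \sum_(i in V | i != j) paired l i j;
  Pi_prec : forall i j, i \in V -> j \in V -> prec H i j -> paired l i j = 0 }.

(* The double sum counts every unordered pair twice. *)
Definition Pi_objective (l : lpvar) : R :=
  \sum_(j in V) alone l j
  + (\sum_(i in V) \sum_(j in V | j != i) paired l i j) / 2.

Definition Pi_optimal (d : J -> R) (l : lpvar) : Prop :=
  Pi_feasible d l /\
  forall l', Pi_feasible d l' -> Pi_objective l <= Pi_objective l'.

End LinearProgram.

Definition P3_feasible (R : realType) (J : finType) (G : rel J)
    (e : J -> R -> R) (E : R) (d : J -> R) (l : lpvar R J) : Prop :=
  [/\ forall j, 0 <= d j, Pi_feasible [set: J]%SET G d l &
      \sum_(j : J) e j (d j) <= E].

Section Procedure.
Variables (R : realType) (J : finType) (G : rel J).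

(* The task set of G_l, the residual durations and the schedule built so far;
   the edges of G_l are those of G between the remaining tasks. *)
Record state : Type := State {
  tasks : {set J};
  residual : J -> R;
  partial : schedule R J 2 }.

Definition alone_block (s : J) (p : 'I_2) : J -> option 'I_2 :=
  fun j => if j == s then Some p else None.

(* [rev_ord p] is the processor other than [p]. *)
Definition paired_block (s i : J) (p : 'I_2) : J -> option 'I_2 :=
  fun j => if j == s then Some p else if j == i then Some (rev_ord p) else None.

(* [r] lists the other remaining tasks in the order of their blocks, and [p]
   gives the processor of [s] in each block ([p s] for the block of [s] alone). *)
Definition run_source (sigma : schedule R J 2) (l : lpvar R J) (s : J)
    (r : seq J) (p : J -> 'I_2) : schedule R J 2 :=
  foldl (fun tau i => append_block tau (paired_block s i (p i)) (paired l s i))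
    (append_block sigma (alone_block s (p s)) (alone l s)) r.

(* All choices left open by the procedure (optimal solution, source, order of
   the blocks, processors) are nondeterministic. *)
Variant step (st : state) : state -> Prop :=
| Step (l : lpvar R J) (s : J) (r : seq J) (p : J -> 'I_2) of
    Pi_optimal (tasks st) (induced G (tasks st)) (residual st) l &
    s \in sources (tasks st) (induced G (tasks st)) &
    (forall j, j \in tasks st ->
       j \notin sources (tasks st) (induced G (tasks st)) ->
       paired l s j = 0) &
    perm_eq r (enum (tasks st :\ s)%SET) :
    step st (State (tasks st :\ s)%SET
                   (fun i => residual st i - paired l s i)
                   (run_source (partial st) l s r p)).

Definition initial (d : J -> R) : state :=
  State [set: J]%SET d (@empty_schedule R J 2).

Inductive reached (d : J -> R) : nat -> state -> Prop :=
| Reached0 : reached d 0 (initial d)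
| ReachedS k st st' of reached d k st & step st st' : reached d k.+1 st'.

Definition produced (d : J -> R) (sigma : schedule R J 2) : Prop :=
  exists2 st, reached d #|J| st & partial st = sigma.

End Procedure.

(* Main.v *)
Require Import Defs.
From mathcomp Require Import all_boot all_order all_algebra.
From mathcomp Require Import reals.
From mathcomp Require Import lra.
From mathcomp Require boolp classical_sets topology function_spaces.
From mathcomp Require normedtype derive.

(** The engine is an exchange argument.  Among the optimal solutions of the
    linear program pick one that minimizes the total pairing time between
    sources and non-sources (it exists by compactness).  If every source were
    paired with a non-source, start from a positive pair (s, j), take a source
    s' below j and a non-source j' paired with s'.  Then j' is not above j; if
    it is below j, repeat from (s', j'), otherwise shift a small amount of time
    from the pairs (s, j), (s', j') to the pairs (s, s'), (j, j'): the objective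
    is unchanged, but the secondary objective decreases.  Hence some source is
    paired with sources only.

    Deleting such a source from an optimal solution leaves an optimal solution
    for the remaining tasks, and the objective drops by the length of the
    appended blocks; so makespan plus residual optimum is invariant.  Only
    sources of the current graph run in a block, so every predecessor of a
    running task is already finished. *)

Set Implicit Arguments.
Unset Strict Implicit.
Unset Printing Implicit Defensive.

Import Order.TTheory GRing.Theory Num.Theory.

Local Open Scope ring_scope.

(** * Existence of lexicographically optimal solutions *)

Section Compactness.
Import boolp classical_sets topology function_spaces normedtype derive.
Import numFieldNormedType.Exports.

(** Minimizing [f] over [K] leaves a closed sublevel set whose intersection with [K] is again
    compact and nonempty, so [g] attains its minimum there. *)
Lemma compact_lex_min (R : realType) (T : topologicalType) (K : set T)
    (f g : T -> R) :
  (K !=set0)%classic -> compact K -> continuous f -> continuous g ->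
  exists x, [/\ K x, forall y, K y -> f x <= f y &
    forall y, K y -> f y <= f x -> g x <= g y].
Proof.
move=> K0 cK cf cg.
have [x0 /set_mem Kx0 minf] :=
  compact_EVT_min K0 cK (continuous_subspaceT cf).
have cK' : compact (K `&` (f @^-1` [set r | r <= f x0]))%classic.
  apply: compact_closedI => //; apply: preimage_closed; last exact: closed_le.
  by move=> y _; exact: cf.
have [|x /set_mem [Kx fx] ming] :=
  compact_EVT_min _ cK' (continuous_subspaceT cg).
  by exists x0; split => //=.
exists x; split=> // [y Ky|y Ky fyx].
  by apply: le_trans fx _; apply: minf; apply/mem_set.
by apply: ming; apply/mem_set; split=> //=; apply: le_trans fx.
Qed.

(** * Closed conditions on real-valued functions *)

Section RealValuedFunctions.
Variables (R : realType) (T : topologicalType).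

Lemma continuous_add_fun (f g : T -> R) :
  continuous f -> continuous g -> continuous (fun x => f x + g x).
Proof. by move=> cf cg x; apply: continuousD; [exact: cf|exact: cg]. Qed.

Lemma continuous_div_fun (f : T -> R) (c : R) :
  continuous f -> continuous (fun x => f x / c).
Proof. by move=> cf x; apply: (cvgM (cf x)); exact: cvg_cst. Qed.

Lemma continuous_sum_fun (I : Type) (r : seq I) (P : pred I) (F : I -> T -> R) :
  (forall i, P i -> continuous (F i)) ->
  continuous (fun x => \sum_(i <- r | P i) F i x).
Proof. by move=> cF; apply: continuous_big => // x; exact: add_continuous. Qed.

Lemma closed_le_fun (f g : T -> R) :
  continuous f -> continuous g -> closed [set x | f x <= g x]%classic.
Proof.
move=> cf cg.
have -> : [set x | f x <= g x]%classic
          = ((fun x => f x - g x) @^-1` [set r | r <= 0])%classic.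
  by apply/funext => x /=; rewrite subr_le0.
apply: preimage_closed; last exact: closed_le.
by move=> x _; apply: continuousB; [exact: cf|exact: cg].
Qed.

Lemma closed_eq_fun (f g : T -> R) :
  continuous f -> continuous g -> closed [set x | f x = g x]%classic.
Proof.
move=> cf cg.
have -> : [set x | f x = g x]%classic
          = ([set x | f x <= g x] `&` [set x | g x <= f x])%classic.
  apply/seteqP; split=> x /=; first by move=> ->.
  by case=> fg gf; apply/eqP; rewrite eq_le fg.
by apply: closedI; exact: closed_le_fun.
Qed.

Lemma closed_forall (I : Type) (P : I -> Prop) (F : I -> T -> Prop) :
  (forall i, P i -> closed [set x | F i x]%classic) ->
  closed [set x | forall i, P i -> F i x]%classic.
Proof. exact: closed_bigI. Qed.

End RealValuedFunctions.

(** * Compactness of the feasible region *)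

Section LexicographicOptimum.
Variables (R : realType) (J : finType) (V : {set J}) (H : rel J) (d : J -> R).

(** A solution is a point of a finite product of lines: the diagonal carries the times alone, the
    other coordinates the paired times. *)
Let T : topologicalType := prod_topology (fun _ : J * J => R).

Let lp_of (x : T) : lpvar R J :=
  LPVar (fun j => x (j, j)) (fun i j => x (i, j)).

Lemma continuous_coord (p : J * J) : continuous (fun x : T => x p : R).
Proof. exact: (@proj_continuous (J * J)%type (fun=> R) p). Qed.

Lemma Pi_feasible_closed :
  closed [set x : T | Pi_feasible V H d (lp_of x)]%classic.
Proof.
have -> : [set x : T | Pi_feasible V H d (lp_of x)]%classic =
  ([set x : T | forall j, j \in V -> 0 <= (x (j, j) : R)] `&`
   [set x : T | forall p, [/\ p.1 \in V, p.2 \in V & p.1 != p.2] ->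
      0 <= (x p : R)] `&`
   [set x : T | forall p, [/\ p.1 \in V, p.2 \in V & p.1 != p.2] ->
      (x p : R) = x (p.2, p.1)] `&`
   [set x : T | forall j, j \in V ->
      d j = x (j, j) + \sum_(i in V | i != j) (x (i, j) : R)] `&`
   [set x : T | forall p, [/\ p.1 \in V, p.2 \in V & prec H p.1 p.2] ->
      (x p : R) = 0])%classic.
  apply/seteqP; split=> x /=.
    case=> /= h1 h2 h3 h4 h5; split; [split; [split; [split|]|]|] => //.
    - by case=> i j [] /=; exact: h2.
    - by case=> i j [] /=; exact: h3.
    - by case=> i j [] /=; exact: h5.
  case=> [[[[h1 h2] h3] h4] h5]; split.
  - exact: h1.
  - by move=> i j iV jV ij; apply: (h2 (i, j)).
  - by move=> i j iV jV ij; apply: (h3 (i, j)).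
  - exact: h4.
  - by move=> i j iV jV ij; apply: (h5 (i, j)).
have cc (c : R) : continuous (fun _ : T => c) by exact: cst_continuous.
have cx := continuous_coord.
apply: (closedI (closedI (closedI (closedI _ _) _) _) _);
  apply: closed_forall => p _.
- exact: closed_le_fun.
- exact: closed_le_fun.
- exact: closed_eq_fun.
- apply: closed_eq_fun => //; apply: continuous_add_fun; first exact: cx.
  exact: continuous_sum_fun.
- exact: closed_eq_fun.
Qed.

Lemma Pi_alone_le l j : Pi_feasible V H d l -> j \in V -> alone l j <= d j.
Proof.
move=> [h1 h2 h3 h4 h5] jV; rewrite h4// lerDl sumr_ge0// => i /andP[iV ij].
exact: h2.
Qed.

Lemma Pi_paired_le l i j : Pi_feasible V H d l -> i \in V -> j \in V ->
  i != j -> paired l i j <= d j.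
Proof.
move=> [h1 h2 h3 h4 h5] iV jV ij.
rewrite h4// (bigD1 i) ?iV//= addrCA lerDl addr_ge0 ?h1//.
by apply: sumr_ge0 => k /andP[/andP[kV kj] _]; exact: h2.
Qed.

(** [Pi_prec] also covers [i = j], where [paired] is arbitrary; irreflexivity of [prec H] makes that
    case void. *)
Lemma eq_Pi_feasible l l' :
  {in V, alone l =1 alone l'} ->
  (forall i j, i \in V -> j \in V -> i != j -> paired l i j = paired l' i j) ->
  irreflexive (prec H) ->
  Pi_feasible V H d l -> Pi_feasible V H d l'.
Proof.
move=> ea ep Hirr [h1 h2 h3 h4 h5]; split.
- by move=> j jV; rewrite -ea ?h1.
- by move=> i j iV jV ij; rewrite -ep ?h2.
- by move=> i j iV jV ij; rewrite -ep// -ep 1?eq_sym// h3.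
- move=> j jV; rewrite h4// ea//; congr (_ + _).
  by apply: eq_bigr => i /andP[iV ij]; exact: ep.
- move=> i j iV jV Hij; rewrite -ep ?h5//.
  by apply: contraTneq Hij => ->; rewrite Hirr.
Qed.

Lemma eq_Pi_objective (l l' : lpvar R J) :
  {in V, alone l =1 alone l'} ->
  (forall i j, i \in V -> j \in V -> i != j -> paired l i j = paired l' i j) ->
  Pi_objective V l = Pi_objective V l'.
Proof.
move=> ea ep; rewrite /Pi_objective; congr (_ + _ / 2); first exact: eq_bigr.
apply: eq_bigr => i iV; apply: eq_bigr => j /andP[jV ji].
by rewrite ep// eq_sym.
Qed.

Lemma Pi_lex_optimal (S : {set J}) l0 :
  S \subset V -> irreflexive (prec H) -> Pi_feasible V H d l0 ->
  exists2 l, Pi_optimal V H d l &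
    forall l', Pi_optimal V H d l' ->
    \sum_(a in S) \sum_(b in V :\: S) paired l a b
    <= \sum_(a in S) \sum_(b in V :\: S) paired l' a b.
Proof.
move=> SV Hirr fl0.
(* Feasible values in [V] lie between 0 and the duration. Outside [V] the sign of [d] is unknown,
   and the absolute value keeps 0 in the interval. *)
pose box : set T := [set x : T |
  forall p, `[0, `|d p.2| ]%classic (x p)]%classic.
(* Resetting the meaningless coordinates to 0 brings every feasible solution into the box and
   changes neither feasibility nor the two objectives. *)
pose trunc (l : lpvar R J) : T := fun p =>
  if (p.1 \in V) && (p.2 \in V) then
    if p.1 == p.2 then alone l p.1 else paired l p.1 p.2
  else 0.
have trunc_alone l : {in V, alone l =1 alone (lp_of (trunc l))}.
  by move=> j jV; rewrite /= /trunc /= jV eqxx.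
have trunc_paired l i j : i \in V -> j \in V -> i != j ->
    paired l i j = paired (lp_of (trunc l)) i j.
  by move=> iV jV ij; rewrite /= /trunc /= iV jV (negPf ij).
pose K : set T :=
  (box `&` [set x : T | Pi_feasible V H d (lp_of x)])%classic.
have K_trunc l : Pi_feasible V H d l -> K (trunc l).
  move=> fl; split; last first.
    by apply: (eq_Pi_feasible (trunc_alone l) _ Hirr fl) => i j;
      exact: trunc_paired.
  case=> i j; rewrite /trunc/= in_itv/=.
  case: ifPn => [/andP[iV jV]|_]; last by rewrite lexx normr_ge0.
  have [<-|ij] := eqVneq i j.
    by rewrite (Pi_alone_ge0 fl)//= (le_trans (Pi_alone_le fl iV)) ?ler_norm.
  rewrite (Pi_paired_ge0 fl)//=.
  by rewrite (le_trans (Pi_paired_le fl iV jV ij)) ?ler_norm.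
have cK : compact K.
  apply: compact_closedI; last exact: Pi_feasible_closed.
  apply: (@tychonoff (J * J)%type (fun=> R) (fun p => `[0, `|d p.2| ]%classic)).
  by move=> p; exact: segment_compact.
pose g (l : lpvar R J) := \sum_(a in S) \sum_(b in V :\: S) paired l a b.
have g_trunc l : g l = g (lp_of (trunc l)).
  apply: eq_bigr => a aS; apply: eq_bigr => b /setDP[bV bS].
  apply: trunc_paired => //; first exact: (fintype.subsetP SV).
  by apply: contraNneq bS => <-.
have obj_trunc l : Pi_objective V l = Pi_objective V (lp_of (trunc l)).
  by apply: eq_Pi_objective => //; exact: trunc_paired.
have cx := continuous_coord.
have [|||x [[_ fx] minx minx']] :=
    @compact_lex_min R T K (fun x => Pi_objective V (lp_of x))
      (fun x => g (lp_of x)) _ cK.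
- by exists (trunc l0); exact: K_trunc.
- apply: continuous_add_fun.
    by apply: continuous_sum_fun => i _; exact: cx.
  apply: continuous_div_fun.
  apply: continuous_sum_fun => i _; apply: continuous_sum_fun => j _.
  exact: cx.
- apply: continuous_sum_fun => i _; apply: continuous_sum_fun => j _.
  exact: cx.
exists (lp_of x) => [|l' [fl' ol']].
  by split=> // l' fl'; rewrite (obj_trunc l'); apply: minx; exact: K_trunc.
by rewrite -/(g l') g_trunc; apply: minx';
  [exact: K_trunc|rewrite -obj_trunc ol'].
Qed.
End LexicographicOptimum.

End Compactness.

(** * The exchange argument *)

Section Precedence.
Variables (J : finType) (H : rel J).

Lemma edge_prec i j : H i j -> prec H i j.
Proof. by move=> Hij; apply/existsP; exists j; rewrite Hij connect0. Qed.

Lemma prec_trans : transitive (prec H).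
Proof.
move=> j i k /existsP[a /andP[Hia aj]] /existsP[b /andP[Hjb bk]].
apply/existsP; exists a; rewrite Hia (connect_trans aj)//.
exact: connect_trans (connect1 Hjb) bk.
Qed.

Lemma prec_last_edge i j : prec H i j -> exists k, H k j.
Proof.
move=> /existsP[k /andP[Hik /connectP[p + ->]]].
case/lastP: p => [|p x]; first by exists i.
by rewrite rcons_path last_rcons => /andP[_ Hx]; exists (last k p).
Qed.

Lemma acyclic_prec_irr : acyclic H -> irreflexive (prec H).
Proof. by move=> /forallP aH i; apply/negbTE/aH. Qed.

(** The number of predecessors serves as a rank for induction: by transitivity [j] inherits the
    predecessors of [i], and it has [i] in addition. *)
Lemma prec_card_ltn i j : irreflexive (prec H) -> prec H i j ->
  (#|[set k | prec H k i]| < #|[set k | prec H k j]|)%N.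
Proof.
move=> Hirr Hij; apply: proper_card; apply/properP; split.
  by apply/subsetP => k; rewrite !inE => /prec_trans; apply.
by exists i; rewrite !inE// Hirr.
Qed.

End Precedence.

Section Exchange.
Variables (R : realType) (J : finType) (V : {set J}) (H : rel J) (d : J -> R).
Hypotheses (Hirr : irreflexive (prec H))
  (HV : forall i j, H i j -> (i \in V) && (j \in V)).

Let S := sources V H.

Lemma source_in s : s \in S -> s \in V.
Proof. by rewrite inE => /andP[]. Qed.

Lemma source_not_prec i s : s \in S -> prec H i s = false.
Proof.
rewrite inE => /andP[_ /forall_inP sS]; apply/negbTE/negP => His.
have [k Hks] := prec_last_edge His.
by have /andP[kV _] := HV Hks; move: (sS k kV); rewrite Hks.
Qed.

(** Going back along edges from a non-source stays inside [V] and lowers the rank, so it ends at a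
    source. *)
Lemma source_below j : j \in V -> j \notin S -> exists2 s, s \in S & prec H s j.
Proof.
have [n] := ubnP #|[set k | prec H k j]|%SET.
elim: n => // n IHn in j *; rewrite ltnS => jn jV.
rewrite inE jV negb_forall_in => /exists_inP[i iV]; rewrite negbK => Hij.
have [iS|iS] := boolP (i \in S); first by exists i => //; exact: edge_prec.
have [|s sS si] := IHn i _ iV iS.
  exact: leq_trans (prec_card_ltn Hirr (edge_prec Hij)) jn.
by exists s => //; apply: prec_trans si (edge_prec Hij).
Qed.

Lemma sources_neq0 : V != set0 -> S != set0.
Proof.
case/set0Pn => j jV; apply/set0Pn.
have [jS|jS] := boolP (j \in S); first by exists j.
by have [s sS _] := source_below jV jS; exists s.
Qed.

(** Strong induction on the rank of [j0]: whenever the new non-source [j'] lies below [j0], the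
    search restarts from [s'] and [j']. *)
Lemma crossing_pairs (l : lpvar R J) : Pi_feasible V H d l -> V != set0 ->
  (forall s, s \in S ->
    exists j, [/\ j \in V, j \notin S & 0 < paired l s j]) ->
  exists s s' j j',
   [/\ [/\ s \in S, s' \in S & s != s'],
       [/\ j \in V :\: S, j' \in V :\: S & j != j'],
       0 < paired l s j, 0 < paired l s' j' &
       ~~ prec H j j' && ~~ prec H j' j].
Proof.
move=> fl V0 cross; have [s0 s0S] := set0Pn _ (sources_neq0 V0).
have [j0 [j0V j0S l0]] := cross _ s0S.
have [n] := ubnP #|[set k | prec H k j0]|%SET.
elim: n => // n IHn in s0 s0S j0 j0V j0S l0 *; rewrite ltnS => jn.
(* A task never precedes a partner with which it shares positive time. *)
have no_prec a b : a \in V -> b \in V -> 0 < paired l a b -> prec H a b = false.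
  move=> aV bV; apply: contraTF => ab.
  by rewrite (Pi_prec fl) ?ltxx.
have [s' s'S s'j0] := source_below j0V j0S.
have [j' [j'V j'S l']] := cross _ s'S.
have s'V := source_in s'S; have s0V := source_in s0S.
have s0s' : s0 != s'.
  by apply: contraTneq s'j0 => <-; rewrite no_prec.
(* Otherwise [s'] would precede its own partner [j'] through [j0]. *)
have j0j' : ~~ prec H j0 j'.
  by apply/negP => /(prec_trans s'j0); rewrite no_prec.
have [j'j0|j'j0] := boolP (prec H j' j0).
  apply: (IHn s' s'S j') => //.
  exact: leq_trans (prec_card_ltn Hirr j'j0) jn.
have jj' : j0 != j' by apply: contraTneq s'j0 => ->; rewrite no_prec.
exists s0, s', j0, j'; split; rewrite ?j0j' //; split => //; apply/setDP;
  by split.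
Qed.

(** Summing the duration constraints counts each pair twice. With [d] fixed, the objective thus
    depends only on the total time that tasks run alone. *)
Lemma Pi_objectiveE (l : lpvar R J) : Pi_feasible V H d l ->
  Pi_objective V l = (\sum_(j in V) d j + \sum_(j in V) alone l j) / 2.
Proof.
move=> fl; rewrite /Pi_objective.
under [X in _ = (X + _) / 2]eq_bigr => j jV do rewrite (Pi_duration fl jV).
rewrite big_split /=.
have -> : \sum_(i in V) \sum_(j in V | j != i) paired l i j =
          \sum_(i in V) \sum_(j in V | j != i) paired l j i.
  apply: eq_bigr => i iV; apply: eq_bigr => j /andP[jV ji].
  by apply: (Pi_paired_sym fl); rewrite // eq_sym.
lra.
Qed.

(** The indicator of the unordered pair {u, v}, which lets a change of paired times be written as
    one formula. *)
Definition pair_ind (u v a b : J) : R :=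
  ((a == u) && (b == v) || (a == v) && (b == u))%:R.

Lemma pair_indC u v a b : pair_ind u v a b = pair_ind u v b a.
Proof. by rewrite /pair_ind orbC ![(b == _) && _]andbC. Qed.

Lemma pair_ind_ge0 u v a b : 0 <= pair_ind u v a b.
Proof. exact: ler0n. Qed.

Lemma sum_pair_ind u v b : u \in V -> v \in V -> u != v ->
  \sum_(a in V | a != b) pair_ind u v a b = (b == u)%:R + (b == v)%:R.
Proof.
move=> uV vV uv.
have aux w w' : w \in V -> w != w' ->
    \sum_(a in V | a != b) ((a == w) && (b == w'))%:R = (b == w')%:R :> R.
  move=> wV ww'; have [->|bw'] := eqVneq b w'; last first.
    by rewrite big1// => a _; rewrite andbF.
  rewrite (bigD1 w) ?wV ?ww'//= eqxx big1 ?addr0// => a /andP[_ /negPf->//].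
(* Since [u] and [v] differ, the two ordered cases exclude each other, so the indicator of the
   disjunction is a sum. *)
transitivity (\sum_(a in V | a != b)
    (((a == u) && (b == v))%:R + ((a == v) && (b == u))%:R : R)).
  apply: eq_bigr => a _; rewrite /pair_ind.
  have [->|au] := eqVneq a u; rewrite ?(negPf uv) ?orbF ?addr0//=.
  by rewrite add0r.
by rewrite big_split /= !aux// 1?eq_sym// addrC.
Qed.

(** * Shifting time between two crossing pairs *)

Section Swap.
Variables (l : lpvar R J) (s s' j j' : J) (c : R).
Hypotheses (fl : Pi_feasible V H d l)
  (sS : s \in S) (s'S : s' \in S) (ss' : s != s')
  (jV : j \in V :\: S) (j'V : j' \in V :\: S) (jj' : j != j')
  (njj' : ~~ prec H j j') (nj'j : ~~ prec H j' j)
  (c_gt0 : 0 < c) (c_le : c <= paired l s j) (c_le' : c <= paired l s' j').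

(** Each of the four tasks gains [c] in one pair and loses [c] in another, so all durations stay the
    same. *)
Definition swap : lpvar R J :=
  LPVar (alone l) (fun a b => paired l a b
    + c * (pair_ind s s' a b + pair_ind j j' a b
           - pair_ind s j a b - pair_ind s' j' a b)).

Lemma swap_feasible : Pi_feasible V H d swap.
Proof.
have [jV' jS] := setDP jV; have [j'V' j'S] := setDP j'V.
have sV := source_in sS; have s'V := source_in s'S.
have sj : s != j by apply: contraNneq jS => <-.
have sj' : s != j' by apply: contraNneq j'S => <-.
have s'j : s' != j by apply: contraNneq jS => <-.
have s'j' : s' != j' by apply: contraNneq j'S => <-.
have c0 := ltW c_gt0.
split=> /=.
- exact: Pi_alone_ge0 fl.
- move=> a b aV bV ab.
  (* The pairs {s, j} and {s', j'} are different, so at most one loss of [c] occurs at each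
     position. *)
  have le_paired : c * (pair_ind s j a b + pair_ind s' j' a b) <= paired l a b.
    rewrite /pair_ind; case: orP => [[]/andP[/eqP ea /eqP eb]|_].
    - by rewrite ea eb (negPf ss') (negPf sj') /= addr0 mulr1.
    - rewrite ea eb (negPf ss') (negPf sj') !andbF /= addr0 mulr1.
      by rewrite (Pi_paired_sym fl)// 1?eq_sym.
    case: orP => [[]/andP[/eqP ea /eqP eb]|_].
    - by rewrite ea eb add0r mulr1.
    - by rewrite ea eb add0r mulr1 (Pi_paired_sym fl)// 1?eq_sym.
    by rewrite addr0 mulr0 (Pi_paired_ge0 fl).
  have c1 := mulr_ge0 c0 (pair_ind_ge0 s s' a b).
  have c2 := mulr_ge0 c0 (pair_ind_ge0 j j' a b).
  lra.
- move=> a b aV bV ab.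
  by rewrite (Pi_paired_sym fl)// ![pair_ind _ _ a b]pair_indC.
- move=> b bV; rewrite (Pi_duration fl bV) big_split /= -mulr_sumr !sumrB.
  rewrite big_split /= !sum_pair_ind//.
  lra.
(* No changed pair is comparable: those that gain time are two sources or [j] and [j'], and those
   that lose time had positive time. *)
- move=> a b aV bV ab; have lab := Pi_prec fl aV bV ab.
  have lsj : 0 < paired l s j by exact: lt_le_trans c_le.
  have ls'j' : 0 < paired l s' j' by exact: lt_le_trans c_le'.
  rewrite lab /pair_ind; case: orP => [[]/andP[/eqP ea /eqP eb]|_].
  - by rewrite eb source_not_prec in ab.
  - by rewrite eb source_not_prec in ab.
  case: orP => [[]/andP[/eqP ea /eqP eb]|_].
  - by rewrite ea eb (negPf njj') in ab.
  - by rewrite ea eb (negPf nj'j) in ab.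
  case: orP => [[]/andP[/eqP ea /eqP eb]|_].
  - by rewrite -ea -eb lab ltxx in lsj.
  - by rewrite eb source_not_prec in ab.
  case: orP => [[]/andP[/eqP ea /eqP eb]|_].
  - by rewrite -ea -eb lab ltxx in ls'j'.
  - by rewrite eb source_not_prec in ab.
  by rewrite !subr0 addr0 mulr0 addr0.
Qed.

(** Neither pair that gains time crosses from sources to non-sources, while the pair of [s] and [j]
    does and loses [c > 0]. *)
Lemma swap_cross_lt :
  \sum_(a in S) \sum_(b in V :\: S) paired swap a b
  < \sum_(a in S) \sum_(b in V :\: S) paired l a b.
Proof.
have paired_le a b : a \in S -> b \in V :\: S ->
    paired swap a b <= paired l a b - c * pair_ind s j a b.
  move=> aS /setDP[bV bS] /=.
  have -> : pair_ind s s' a b = 0.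
    by rewrite /pair_ind; case: orP => // -[]/andP[_ /eqP eb];
      rewrite eb ?sS ?s'S in bS.
  have -> : pair_ind j j' a b = 0.
    have [_ jS] := setDP jV; have [_ j'S] := setDP j'V.
    by rewrite /pair_ind; case: orP => // -[]/andP[/eqP ea _];
      rewrite -ea aS in jS j'S.
  have := mulr_ge0 (ltW c_gt0) (pair_ind_ge0 s' j' a b).
  lra.
rewrite (bigD1 s)//= [ltRHS](bigD1 s)//=; apply: ltr_leD.
  rewrite (bigD1 j)//= [ltRHS](bigD1 j)//=; apply: ltr_leD.
    apply: le_lt_trans (paired_le _ _ sS jV) _.
    by rewrite /pair_ind !eqxx /= mulr1 gtrBl.
  apply: ler_sum => b /andP[bV _]; apply: le_trans (paired_le _ _ sS bV) _.
  by rewrite gerBl mulr_ge0 ?pair_ind_ge0 ?ltW.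
apply: ler_sum => a /andP[aS _]; apply: ler_sum => b bV.
apply: le_trans (paired_le _ _ aS bV) _.
by rewrite gerBl mulr_ge0 ?pair_ind_ge0 ?ltW.
Qed.

End Swap.

Lemma exists_optimal_source l0 : Pi_feasible V H d l0 -> V != set0 ->
  exists l s, [/\ Pi_optimal V H d l, s \in S &
    forall j, j \in V -> j \notin S -> paired l s j = 0].
Proof.
move=> fl0 V0.
have SV : S \subset V by apply/subsetP => s; exact: source_in.
have [l [fl ol] lexl] := Pi_lex_optimal SV Hirr fl0.
exists l; apply: boolp.contrapT => nos.
have [|s [s' [j [j' [[sS s'S ss'] [jV j'V jj'] sj s'j' /andP[njj' nj'j]]]]]] :=
    crossing_pairs fl V0.
  move=> s sS; apply: boolp.contrapT => noj; apply: nos; exists s.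
  split=> // j jV jS.
  have ne_sj : s != j by apply: contraNneq jS => <-.
  apply/eqP; rewrite eq_le (Pi_paired_ge0 fl (source_in sS) jV ne_sj) andbT.
  by rewrite leNgt; apply/negP => sj; apply: noj; exists j.
(* The largest shift that keeps both decreased pairs nonnegative. *)
pose c := Num.min (paired l s j) (paired l s' j').
have c_gt0 : 0 < c by rewrite lt_min sj.
have c_le : c <= paired l s j by rewrite ge_min lexx.
have c_le' : c <= paired l s' j' by rewrite ge_min lexx orbT.
have fsw := swap_feasible fl sS s'S ss' jV j'V jj' njj' nj'j c_gt0 c_le c_le'.
(* The swap does not touch [alone], so the objective is unchanged and the new solution is optimal
   too. *)
have /lexl : Pi_optimal V H d (swap l s s' j j' c).
  by split=> // l' fl'; rewrite (Pi_objectiveE fsw) /= -(Pi_objectiveE fl) ol.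
by rewrite leNgt swap_cross_lt.
Qed.

End Exchange.

(** * Removal of a source *)

Section SuccessorClosed.
Variables (J : finType) (G : rel J).

Definition succ_closed (V : {set J}) : Prop :=
  forall i j, i \in V -> G i j -> j \in V.

(** A path that starts in a successor-closed set never leaves it, so passing to the induced graph
    loses no precedence. *)
Lemma prec_induced V i j : succ_closed V -> i \in V ->
  prec (induced G V) i j = prec G i j.
Proof.
move=> clV iV; apply/existsP/existsP => -[k /andP[Gik kj]]; exists k.
  have /and3P[_ kV ->] := Gik; apply: connect_sub kj => a b /and3P[_ _ Gab].
  exact: connect1.
have kV := clV _ _ iV Gik; rewrite /induced iV kV Gik /=.
case/connectP: kj => p + ->; elim: p k kV {Gik} => [|x p IHp] k kV /=.
  by rewrite connect0.
case/andP=> Gkx /(IHp _ (clV _ _ kV Gkx)); apply: connect_trans.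
by apply: connect1; rewrite kV (clV _ _ kV Gkx).
Qed.

Lemma source_induced_not_prec V i s : succ_closed V ->
  s \in sources V (induced G V) -> i \in V -> ~~ prec G i s.
Proof.
move=> clV sS iV; rewrite -(prec_induced _ clV iV) (source_not_prec _ _ sS)//.
by move=> a b /and3P[-> ->].
Qed.

Lemma succ_closed_remove_source V s : succ_closed V ->
  s \in sources V (induced G V) -> succ_closed (V :\ s).
Proof.
move=> clV sS i j /setD1P[_ iV] Gij; rewrite in_setD1 (clV _ _ iV Gij) andbT.
apply: contraTneq Gij => ->.
apply: contraNN (source_induced_not_prec clV sS iV).
exact: edge_prec.
Qed.

End SuccessorClosed.

(** * Optimality after the removal of one task *)

Section RemoveTask.
Variables (R : realType) (J : finType).
Implicit Types (V : {set J}) (H : rel J) (d : J -> R) (l : lpvar R J).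

Lemma Pi_feasible_sub V H H' d l :
  (forall i j, i \in V -> j \in V -> prec H' i j -> prec H i j) ->
  Pi_feasible V H d l -> Pi_feasible V H' d l.
Proof.
move=> H'H [h1 h2 h3 h4 h5]; split=> // i j iV jV ij.
by apply: h5 => //; exact: H'H.
Qed.

Lemma sum_setD1_neq V (F : J -> R) s j : s \in V -> s != j ->
  \sum_(i in V | i != j) F i = F s + \sum_(i in V :\ s | i != j) F i.
Proof.
move=> sV sj; rewrite (bigD1 s) ?sV//=; congr (_ + _).
by apply: eq_bigl => i; rewrite !inE andbAC [(i \in V) && _]andbC.
Qed.

Lemma sum_neq_setD1 V (F : J -> R) s :
  \sum_(i in V | i != s) F i = \sum_(i in V :\ s) F i.
Proof. by apply: eq_bigl => i; rewrite !inE andbC. Qed.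

(** The double sum meets each pair of [s] once in the row of [s] and once in its column; after
    halving, the difference is the total length of the blocks of [s]. *)
Lemma Pi_objective_remove V l s : s \in V ->
  (forall i, i \in V -> i != s -> paired l i s = paired l s i) ->
  Pi_objective V l =
  Pi_objective (V :\ s) l + (alone l s + \sum_(i in V :\ s) paired l s i).
Proof.
move=> sV sym; rewrite /Pi_objective (big_setD1 s sV) /=.
rewrite [X in _ + X / 2](big_setD1 s sV) /= sum_neq_setD1.
have -> : \sum_(i in V :\ s) \sum_(j in V | j != i) paired l i j =
    \sum_(i in V :\ s) paired l s i +
    \sum_(i in V :\ s) \sum_(j in V :\ s | j != i) paired l i j.
  rewrite -big_split; apply: eq_bigr => i /setD1P[is' iV].
  by rewrite (sum_setD1_neq _ sV) 1?eq_sym// sym.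
lra.
Qed.

Lemma Pi_feasible_remove V H d l s : s \in V -> Pi_feasible V H d l ->
  Pi_feasible (V :\ s) H (fun i => d i - paired l s i) l.
Proof.
move=> sV [h1 h2 h3 h4 h5]; split.
- by move=> j /setD1P[_]; exact: h1.
- by move=> i j /setD1P[_ iV] /setD1P[_ jV]; exact: h2.
- by move=> i j /setD1P[_ iV] /setD1P[_ jV]; exact: h3.
- move=> j /setD1P[js jV].
  by rewrite h4// (sum_setD1_neq _ sV) 1?eq_sym//; lra.
- by move=> i j /setD1P[_ iV] /setD1P[_ jV]; exact: h5.
Qed.

Definition restore s l l' : lpvar R J :=
  LPVar (fun j => if j == s then alone l j else alone l' j)
        (fun i j => if (i == s) || (j == s) then paired l i j
                    else paired l' i j).

Lemma Pi_feasible_restore V H d l l' s : s \in V -> Pi_feasible V H d l ->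
  Pi_feasible (V :\ s) H (fun i => d i - paired l s i) l' ->
  Pi_feasible V H d (restore s l l').
Proof.
move=> sV [h1 h2 h3 h4 h5] [g1 g2 g3 g4 g5].
have inD i : i \in V -> i != s -> i \in V :\ s by rewrite in_setD1 => -> ->.
split=> /=.
- by move=> j jV; case: eqVneq => js; [exact: h1|exact: (g1 _ (inD _ jV js))].
- move=> i j iV jV ij; case: (eqVneq i s) => is' /=; first exact: h2.
  by case: (eqVneq j s) => js; [exact: h2|apply: g2 => //; exact: inD].
- move=> i j iV jV ij; rewrite [(j == s) || _]orbC.
  case: (eqVneq i s) => is' /=; first exact: h3.
  by case: (eqVneq j s) => js; [exact: h3|apply: g3 => //; exact: inD].
- move=> j jV; case: (eqVneq j s) => [->|js].
    rewrite h4//; congr (_ + _); apply: eq_bigr => i _; by rewrite orbT.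
  rewrite (sum_setD1_neq _ sV) 1?eq_sym// eqxx /=.
  under eq_bigr => i /andP[/setD1P[/negPf-> _] _] do rewrite /=.
  by have := g4 _ (inD _ jV js); lra.
- move=> i j iV jV ij; case: (eqVneq i s) => is' /=; first exact: h5.
  by case: (eqVneq j s) => js; [exact: h5|apply: g5 => //; exact: inD].
Qed.

(** A better solution [l'] for the remaining tasks, glued by [restore] to the part of [l] at [s],
    would improve on [l], since the contribution of [s] is the same in both. *)
Lemma Pi_optimal_remove V H d l s : s \in V -> Pi_optimal V H d l ->
  Pi_optimal (V :\ s) H (fun i => d i - paired l s i) l.
Proof.
move=> sV [fl ol]; split=> [|l' fl']; first exact: Pi_feasible_remove.
have fr := Pi_feasible_restore sV fl fl'.
have := ol _ fr; rewrite !(Pi_objective_remove sV); last 2 first.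
- by move=> i iV is'; apply: (Pi_paired_sym fr).
- by move=> i iV is'; apply: (Pi_paired_sym fl).
have -> : Pi_objective (V :\ s) (restore s l l') = Pi_objective (V :\ s) l'.
  apply: eq_Pi_objective => [i|i j] /setD1P[/negPf is' _] /=; rewrite is'//.
  by case/setD1P => /negPf ->.
by rewrite /= eqxx /=; lra.
Qed.

End RemoveTask.

(** * Schedules built from blocks *)

Section Blocks.
Variables (R : realType) (J : finType) (m : nat).
Implicit Types (sigma : schedule R J m) (b : J -> option 'I_m).

Lemma makespan_leP sigma x :
  reflect (0 <= x /\ forall j q, q \in sigma j -> stop q <= x)
          (makespan sigma <= x).
Proof.
apply: (iffP (bigmax_leP _ _ _ _)) => -[x0 le]; split=> // j.
  by move=> q qj; apply: le_trans (le j isT); exact: le_bigmax_seq.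
by move=> _; rewrite big_seq; apply: bigmax_le => // q; exact: le.
Qed.

Lemma makespan_ge0 sigma : 0 <= makespan sigma.
Proof. by have /makespan_leP[] := lexx (makespan sigma). Qed.

Lemma stop_le_makespan sigma j q : q \in sigma j -> stop q <= makespan sigma.
Proof. by have /makespan_leP[_] := lexx (makespan sigma); apply. Qed.

Lemma append_block_le0 sigma b len : len <= 0 ->
  append_block sigma b len = sigma.
Proof.
move=> len0; apply/boolp.funext => j; rewrite /append_block ltNge len0.
by case: (b j).
Qed.

Lemma mem_append_block sigma b len j q : 0 < len ->
  reflect (q \in sigma j \/ exists2 p, b j = Some p &
             q = (p, (makespan sigma, makespan sigma + len)))
          (q \in append_block sigma b len j).
Proof.
move=> len0; rewrite /append_block len0.
case: (b j) => [p|].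
  rewrite mem_rcons inE; apply: (iffP orP) => -[].
  - by move/eqP; right; exists p.
  - by left.
  - by right.
  - by case=> _ [<-] ->; left.
by apply: (iffP idP) => [|[]//[]//]; left.
Qed.

Lemma makespan_append_block sigma b len j p : 0 <= len -> b j = Some p ->
  makespan (append_block sigma b len) = makespan sigma + len.
Proof.
rewrite le_eqVlt => /predU1P[<-|len0] bj.
  by rewrite append_block_le0 ?addr0.
apply/eqP; rewrite eq_le; apply/andP; split.
  apply/makespan_leP; split; first by rewrite addr_ge0 ?makespan_ge0 ?ltW.
  move=> i q /mem_append_block-/(_ len0)[/stop_le_makespan qi|[p' _ ->]//].
  by rewrite (le_trans qi)// lerDl ltW.
apply: (@stop_le_makespan _ j (p, (makespan sigma, makespan sigma + len))).
by apply/mem_append_block => //; right; exists p.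
Qed.

Lemma duration_append_block sigma b len j : 0 <= len ->
  duration (append_block sigma b len) j
  = duration sigma j + (if b j is Some _ then len else 0).
Proof.
rewrite le_eqVlt => /predU1P[<-|len0].
  by rewrite append_block_le0//; case: (b j); rewrite addr0.
rewrite /duration /append_block len0; case: (b j) => [p|];
  last by rewrite addr0.
by rewrite big_rcons /= /stop /start /= addrAC subrr add0r addrC.
Qed.

Variable G : rel J.

(* [V] is the set of tasks that are still to be scheduled; the last clause
   keeps precedence true when more slots are appended. *)
Record consistent (V : {set J}) sigma : Prop := Consistent {
  consistent_slot : forall j q, q \in sigma j -> 0 <= start q < stop q;
  consistent_task : forall j, pairwise (@time_disjoint R m) (sigma j);
  consistent_prec : forall i j, prec G i j ->
    forall p q, p \in sigma i -> q \in sigma j -> stop p <= start q;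
  consistent_proc : forall i j, i != j ->
    forall p q, p \in sigma i -> q \in sigma j -> proc p = proc q ->
    time_disjoint p q;
  consistent_nil : forall i j, i \in V -> prec G i j -> sigma j = [::] }.

(** The block begins at the old makespan, so new conflicts arise only inside it: its tasks have no
    predecessor in [V], hence are unordered, and use different processors. Their successors have no
    slots yet, by [consistent_nil]. For length 0 no slot is added, so minimality is asked for only
    when [len] is positive. *)
Lemma consistent_append_block (V : {set J}) sigma b (len : R) :
  (0 < len -> forall j, b j ->
     j \in V /\ forall i, i \in V -> ~~ prec G i j) ->
  (forall i j p, b i = Some p -> b j = Some p -> i = j) ->
  consistent V sigma -> consistent V (append_block sigma b len).
Proof.
move=> bV b_inj [c1 c2 c3 c4 c5].
have [len0|len0] := ltP 0 len; last by rewrite append_block_le0.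
have {}bV j p : b j = Some p -> j \in V /\ forall i, i \in V -> ~~ prec G i j.
  by move=> bj; apply: bV => //; rewrite bj.
have ms0 := makespan_ge0 sigma.
split.
- move=> j q /(mem_append_block _ _ _ _ len0)[|[p _ ->]]; first exact: c1.
  by rewrite /start /stop /= ms0 ltrDl.
- move=> j; rewrite /append_block len0; case: (b j) => // p.
  rewrite pairwise_rcons c2 andbT; apply/allP => q /stop_le_makespan qm.
  by rewrite /time_disjoint qm.
- move=> i j ij p q /(mem_append_block _ _ _ _ len0)[pi|[x bi ->]];
    move=> /(mem_append_block _ _ _ _ len0)[qj|[y bj ->]].
  + exact: c3 ij _ _ pi qj.
  + exact: stop_le_makespan pi.
  + by rewrite (c5 i j) // in qj; have [] := bV _ _ bi.
  + have [iV _] := bV _ _ bi; have [_ /(_ i iV)] := bV _ _ bj.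
    by rewrite ij.
- move=> i j ij p q /(mem_append_block _ _ _ _ len0)[pi|[x bi ->]];
    move=> /(mem_append_block _ _ _ _ len0)[qj|[y bj ->]].
  + exact: c4 ij _ _ pi qj.
  + by rewrite /time_disjoint (stop_le_makespan pi).
  + by rewrite /time_disjoint (stop_le_makespan qj) orbT.
  + rewrite /proc /= => xy; rewrite xy in bi.
    by rewrite (b_inj _ _ _ bi bj) eqxx in ij.
- move=> i j iV ij; rewrite /append_block; case bj: (b j) => [p|];
    last exact: c5 ij.
  by have [_ /(_ i iV)] := bV _ _ bj; rewrite ij.
Qed.

End Blocks.

(** * The blocks of one source *)

Section RunSource.
Variables (R : realType) (J : finType) (G : rel J) (V : {set J}).
Variables (l : lpvar R J) (s : J) (p : J -> 'I_2).
Hypotheses (alone_ge0 : 0 <= alone l s)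
  (paired_ge0 : forall i, i \in V :\ s -> 0 <= paired l s i)
  (s_min : s \in V /\ forall i, i \in V -> ~~ prec G i s)
  (partner_min : forall j, j \in V :\ s -> 0 < paired l s j ->
     forall i, i \in V -> ~~ prec G i j).

Lemma paired_block_inj i q a b x :
  paired_block s i q a = Some x -> paired_block s i q b = Some x -> a = b.
Proof.
(* Reversal has no fixed point on two processors. *)
have neq_rev (y : 'I_2) : y = rev_ord y -> False.
  by case: y => -[|[|//]] ? /(congr1 val).
rewrite /paired_block.
case: (eqVneq a s) => [->|_]; case: (eqVneq b s) => [->|_] //.
- by case: eqVneq => // _ [->] [E]; case: (neq_rev _ (esym E)).
- by case: eqVneq => // _ [<-] [E]; case: (neq_rev _ E).
by case: (eqVneq a i) => [->|//]; case: (eqVneq b i) => [->|].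
Qed.

Lemma alone_block_inj q a b x :
  alone_block s q a = Some x -> alone_block s q b = Some x -> a = b.
Proof. by rewrite /alone_block; case: eqVneq => [->|//]; case: eqVneq. Qed.

(** Induction on the list from its end, matching the left fold. Every block runs [s], so the
    makespan and the duration of [s] both grow by every block length. *)
Lemma run_source_spec sigma r : uniq r -> {subset r <= V :\ s} ->
  consistent G V sigma ->
  let tau := run_source sigma l s r p in
  [/\ consistent G V tau,
      makespan tau
        = makespan sigma + (alone l s + \sum_(i <- r) paired l s i) &
      forall j, duration tau j = duration sigma j +
        (if j == s then alone l s + \sum_(i <- r) paired l s i
         else if j \in r then paired l s j else 0)].
Proof.
elim/last_ind: r => [|r i IHr] /=.
  move=> _ _ cs; rewrite /run_source /= big_nil addr0; split.
  - apply: consistent_append_block cs; last exact: alone_block_inj.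
    by move=> _ j; rewrite /alone_block; case: eqVneq => [->|].
  - apply: (@makespan_append_block _ _ _ _ _ _ s (p s)) => //.
    by rewrite /alone_block eqxx.
  - move=> j; rewrite duration_append_block// /alone_block.
    by case: eqVneq.
rewrite rcons_uniq => /andP[ir ur] rV cs.
have iV : i \in V :\ s by apply: rV; rewrite mem_rcons mem_head.
have [|ct mt dt] := IHr ur _ cs.
  by move=> j jr; apply: rV; rewrite mem_rcons inE jr orbT.
have {iV}[is' iV lsi] : [/\ i != s, i \in V & 0 <= paired l s i].
  by have := paired_ge0 iV; case/setD1P: iV.
rewrite /run_source foldl_rcons -/(run_source sigma l s r p).
rewrite big_rcons /=; split.
- apply: consistent_append_block ct; last exact: paired_block_inj.
  move=> lsi0 j; rewrite /paired_block; case: eqVneq => [->//|js].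
  case: eqVneq => [->|//] _; split=> // k kV.
  by apply: (partner_min _ lsi0) => //; rewrite in_setD1 is'.
- rewrite (@makespan_append_block _ _ _ _ _ _ s (p i)) ?mt//; first lra.
  by rewrite /paired_block eqxx.
- move=> j; rewrite duration_append_block// dt mem_rcons inE /paired_block.
  case: (eqVneq j s) => [_|js]; first lra.
  case: (eqVneq j i) => [->|ji] /=; last by rewrite addr0.
  by rewrite (negPf ir); lra.
Qed.

End RunSource.

(** * The invariant of the procedure *)

Section Invariant.
Variables (R : realType) (J : finType) (G : rel J) (d : J -> R) (opt : R).
Hypothesis (G_acyclic : acyclic G).

(** The core is [inv_optimal]: time already used plus the optimum of the remaining program stays
    equal to [opt]. Once no task is left, [inv_duration] says that each task has run for exactly
    [d j]. *)
Record invariant (k : nat) (st : state R J) : Prop := Invariant {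
  inv_card : (#|tasks st| + k)%N = #|J|;
  inv_closed : succ_closed G (tasks st);
  inv_consistent : consistent G (tasks st) (partial st);
  inv_duration : forall j, duration (partial st) j
    + (if j \in tasks st then residual st j else 0) = d j;
  inv_optimal : exists2 l,
    Pi_optimal (tasks st) (induced G (tasks st)) (residual st) l &
    makespan (partial st) + Pi_objective (tasks st) l = opt }.

Lemma induced_prec_irr (V : {set J}) : irreflexive (prec (induced G V)).
Proof.
apply: acyclic_prec_irr; apply/forallP => i.
apply: contraNN (forallP G_acyclic i).
move=> /existsP[k /andP[/and3P[_ _ Gik] ki]]; apply/existsP; exists k.
by rewrite Gik; apply: connect_sub ki => a b /and3P[_ _]; exact: connect1.
Qed.

Lemma invariant_initial l : Pi_optimal [set: J] G d l ->
  Pi_objective [set: J] l = opt -> invariant 0 (initial d).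
Proof.
move=> [fl ol] obj; have clT : succ_closed G [set: J].
  by move=> i j; rewrite !inE.
have m0 : makespan (@empty_schedule R J 2) = 0.
  apply/eqP; rewrite eq_le makespan_ge0 andbT; apply/makespan_leP.
  by split.
split => //=.
- by rewrite addn0 cardsT.
- by move=> j; rewrite inE /duration big_nil add0r.
exists l; last by rewrite m0 add0r.
split; first by apply: Pi_feasible_sub fl => i j iT _; rewrite prec_induced.
move=> l' fl'; apply: ol; apply: Pi_feasible_sub fl' => i j iT _.
by rewrite prec_induced.
Qed.

Lemma invariant_step k st st' : invariant k st -> step G st st' ->
  invariant k.+1 st'.
Proof.
move=> [cardV clV cs dur [l' [fl' ol'] obj]] stp.
case: stp => l s r p [fl ol] sS lcross rV.
set V := tasks st in cardV clV cs dur fl' ol' obj fl ol sS lcross rV *.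
have sV := source_in sS.
have cl's := succ_closed_remove_source clV sS.
have rVs : r =i V :\ s by move=> i; rewrite (perm_mem rV) mem_enum.
have ur : uniq r by rewrite (perm_uniq rV) enum_uniq.
have alone0 := Pi_alone_ge0 fl sV.
have paired0 i : i \in V :\ s -> 0 <= paired l s i.
  by case/setD1P => is' iV; apply: (Pi_paired_ge0 fl); rewrite // eq_sym.
have s_min := conj sV (fun i => source_induced_not_prec clV sS (i := i)).
(* By the choice of [s], a partner with positive time is a source of the current graph, hence has no
   remaining predecessor. *)
have partner j : j \in V :\ s -> 0 < paired l s j ->
    forall i, i \in V -> ~~ prec G i j.
  case/setD1P => js jV lsj i iV.
  apply: source_induced_not_prec iV => //.
  by apply: contraTT lsj => jS; rewrite lcross ?ltxx.
have sumr : \sum_(i <- r) paired l s i = \sum_(i in V :\ s) paired l s i.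
  by rewrite (perm_big _ rV) /= big_enum.
have sub_r : {subset r <= V :\ s} by move=> i; rewrite rVs.
have [[t1 t2 t3 t4 t5] mk dr] :=
  run_source_spec p alone0 paired0 s_min partner ur sub_r cs.
split=> /=.
- by rewrite -cardV (cardsD1 s V) sV addnS addSn.
- exact: cl's.
- by split=> // i j /setD1P[_ iV]; exact: t5.
- move=> j; rewrite dr -(dur j) rVs in_setD1 -addrA; congr (_ + _).
  case: (eqVneq j s) => [->|js] /=.
    (* The blocks of [s] use up exactly its residual duration. *)
    rewrite sV addr0 sumr (Pi_duration fl sV) sum_neq_setD1; congr (_ + _).
    apply: eq_bigr => i /setD1P[is' iV].
    by rewrite (Pi_paired_sym fl) // eq_sym.
  by case: ifP => _; rewrite ?addr0// addrC subrK.
exists l; last first.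
  rewrite mk sumr -obj.
  (* The solution used by the step need not be the one kept in the invariant, but both are
     optimal. *)
  have -> : Pi_objective V l' = Pi_objective V l.
    by apply/eqP; rewrite eq_le ol ?ol'.
  rewrite (Pi_objective_remove sV); first lra.
  by move=> i iV is'; apply: (Pi_paired_sym fl).
have [fr orr] := Pi_optimal_remove sV (conj fl ol).
(* Optimality after removal refers to the old graph; both task sets are successor-closed, so
   precedence among the remaining tasks is the same in the new one. *)
have eqp i j : i \in V :\ s ->
    prec (induced G (V :\ s)) i j = prec (induced G V) i j.
  by move=> iV; rewrite !prec_induced //; case/setD1P: iV.
split; first by apply: Pi_feasible_sub fr => i j iV _; rewrite eqp.
move=> l2 fl2; apply: orr; apply: Pi_feasible_sub fl2 => i j iV _.
by rewrite eqp.
Qed.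

(** Before iteration [#|J|] some task remains, and the exchange argument supplies a suitable
    solution and source; block order and processors are arbitrary. *)
Lemma invariant_progress k st : (k < #|J|)%N -> invariant k st ->
  exists st', step G st st'.
Proof.
move=> kn [cardV clV cs dur [l' [fl' ol'] obj]].
have V0 : tasks st != set0.
  by apply: contraTneq kn => V0; rewrite -cardV V0 cards0 ltnn.
have HV i j : induced G (tasks st) i j -> (i \in tasks st) && (j \in tasks st).
  by case/and3P=> -> ->.
have [l [s [ol sS lcross]]] :=
  exists_optimal_source (induced_prec_irr _) HV fl' V0.
by eexists; apply: (Step (r := enum (tasks st :\ s)) (fun=> ord0) ol sS lcross).
Qed.

End Invariant.

(** After [#|J|] steps no task remains: the residual objective is an empty sum, so the invariant
    gives the makespan, and all durations equal [d], so the energy bound is that of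
    [P3_feasible]. *)
Theorem theorem3 (R : realType) (J : finType) (G : rel J) (e : J -> R -> R)
    (E : R) (d : J -> R) (l : lpvar R J)
    (G_acyclic : acyclic G)
    (e_energy : forall j, energy_function (e j))
    (E_ge0 : 0 <= E)
    (dl_P3 : P3_feasible G e E d l) :
  (* the procedure never gets stuck before its n-th iteration *)
  (forall k st, (k < #|J|)%N -> reached G d k st -> exists st', step G st st')
  /\
  (forall sigma, produced G d sigma ->
     feasible G e E sigma /\
     exists2 lopt, Pi_optimal [set: J] G d lopt
                 & makespan sigma = Pi_objective [set: J] lopt).
Proof.
have [_ fl e_le] := dl_P3.
(* For the empty set the secondary objective is constantly 0; the point here is only that an optimum
   exists. *)
have [lopt olopt _] :=
  Pi_lex_optimal (sub0set _) (acyclic_prec_irr G_acyclic) fl.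
pose opt := Pi_objective [set: J] lopt.
have inv k st : reached G d k st -> invariant G d opt k st.
  elim=> [|{}k {}st st' _ IH]; first exact: invariant_initial olopt erefl.
  exact: invariant_step IH.
split=> [k st kn /inv|_ [st /inv [cardV _ cs dur [l' _ obj]] <-]].
  exact: invariant_progress.
have V0 : tasks st = set0.
  by apply/eqP; rewrite -cards_eq0 -(eqn_add2r #|J|) cardV.
split; last first.
  exists lopt => //; rewrite -/opt -obj V0 /Pi_objective !big_set0.
  by rewrite mul0r !addr0.
case: cs => c1 c2 c3 c4 _; split=> //.
rewrite (eq_bigr (fun j => e j (d j))) // => j _.
by rewrite -(dur j) V0 inE addr0.
Qed.
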